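(* Let $n,k\ge 1$ and let $F_1,\ldots,F_k$ be subsets of the edge set $E(K_{n,n})$ of the complete bipartite graph with both sides of size $n$. If $$\sum_{i\in I}|F_i|>n|I|(|I|-1)\quad\text{for every nonempty } I\subseteq[k],$$ then the system $(F_1,\ldots,F_k)$ has a rainbow matching, i.e. there exist pairwise disjoint edges $e_1,\ldots,e_k$ with $e_i\in F_i$ for each $i$.
   Context: $[k]=\{1,\ldots,k\}$. A rainbow matching for $(F_1,\ldots,F_k)$ is a choice of pairwise disjoint edges $e_i\in F_i$, one from each $F_i$. *)

(* Defs.v *)
From mathcomp Require Import all_boot.
Set Implicit Arguments. Unset Strict Implicit. Unset Printing Implicit Defensive.

(* Edges of K_{n,n}: pairs (a,b) with a in the left side 'I_n and b in the right side 'I_n. *)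
Definition edge (n : nat) := ('I_n * 'I_n)%type.

Definition disjoint_edges n (e f : edge n) : bool := (e.1 != f.1) && (e.2 != f.2).

Definition rainbow_matching n k (F : 'I_k -> {set edge n}) : Prop :=
  exists e : 'I_k -> edge n,
    (forall i, e i \in F i) /\
    (forall i j, i != j -> disjoint_edges (e i) (e j)).

(* Main.v *)
(** Replace each F_i by the Young diagram L_i with a cell (s, t) whenever more
    than s left vertices have F_i-degree more than t; it has #|F_i| cells.  If
    the coordinates s_i are distinct, the t_i are distinct, and (s_i, t_i) lies
    in L_i, then left ends x_i of degree more than t_i, and after them right
    ends in the neighbourhoods of the x_i, can be chosen greedily.

    It remains to pick such cells for k diagrams.  Call a row or column of L_i
    long if it has at least k cells, and let d_i be the number of long lines.
    - If the d_i sum to at most k(k-1), cutting the diagrams down to the k x k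
      square costs at most (n-k)d_i cells each and leaves more than k^2(k-1)
      cells in all, so one of the k^2 placements (r_i + u, r_i + v) mod k, with
      r a bijection onto Z/k, lies entirely inside the diagrams.
    - Otherwise let J be a largest set with sum of d_i at most |J|(|J|-1).  It
      is proper, so induction places J.  By maximality any I disjoint from J has
      sum of d_i above |I|(|I|-1) + 2|I||J|, so distinct long lines avoiding the
      2|J| lines used by J can be chosen greedily for the remaining indices,
      and a cell with free other coordinate is left on each of them. *)

Require Import Defs.
From mathcomp Require Import all_boot.
From mathcomp Require Import ssralg zmodp zify.
Set Implicit Arguments. Unset Strict Implicit. Unset Printing Implicit Defensive.

(** * Greedy choice of distinct representatives *)

(** Induct on [#|S|]: the [i] supplied by [I = S] is served last, when fewer than [#|S|] values are
    taken. *)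
Lemma greedy_sdr (T U : finType) (u0 : U) (B : T -> {set U}) (S : {set T}) :
  (forall I : {set T}, I \subset S -> I != set0 ->
     exists2 i, i \in I & #|I| <= #|B i|) ->
  exists f : T -> U, {in S &, injective f} /\ {in S, forall i, f i \in B i}.
Proof.
have [m] := ubnP #|S|; elim: m S => // m IHm S ltSm HS.
have [-> | S0] := eqVneq S set0.
  by exists (fun=> u0); split=> i; rewrite inE.
have [i iS leB] := HS S (subxx S) S0.
have cS : #|S| = #|S :\ i|.+1 by rewrite (cardsD1 i) iS.
have [|I sI|f [fI fB]] := IHm (S :\ i); first by rewrite -ltnS -cS.
  by apply: HS; apply: subset_trans sI (subD1set _ _).
have : 0 < #|B i :\: f @: (S :\ i)|.
  rewrite cardsD subn_gt0; apply: leq_trans leB; rewrite cS ltnS.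
  by apply: leq_trans (subset_leq_card (subsetIr _ _)) (leq_imset_card _ _).
case/card_gt0P=> u; rewrite inE => /andP[uf uB].
have neu j : j \in S -> j != i -> f j != u.
  move=> jS ji; apply: contraNneq uf => <-.
  by apply: imset_f; rewrite !inE ji.
exists (fun j => if j == i then u else f j); split=> [j l jS lS | j jS].
  case: (eqVneq j i) => [-> | ji]; case: (eqVneq l i) => [-> | li] //.
  - by move=> e; have := neu l lS li; rewrite -e eqxx.
  - by move=> e; have := neu j jS ji; rewrite e eqxx.
  - by apply: fI; rewrite !inE ?ji ?li.
by case: eqVneq => [-> | ji] //; apply: fB; rewrite !inE ji.
Qed.

Lemma leq_card_preim_image (T V : finType) (W : eqType)
    (g : V -> W) (f : T -> W) (J : {set T}) :
  injective g -> #|[set v | g v \in [seq f j | j in J]]| <= #|J|.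
Proof.
move=> gI; rewrite cardE -(size_map g) -(size_image f J).
apply: uniq_leq_size => [|w /mapP[v]].
  by rewrite map_inj_uniq ?enum_uniq.
by rewrite mem_enum inE => vJ ->.
Qed.

(** The largest of [#|I|] distinct naturals is at least [#|I| - 1]. *)
Lemma exists_geq_card_of_inj (T : finType) (s : T -> nat) (I : {set T}) :
  {in I &, injective s} -> I != set0 -> exists2 i, i \in I & #|I| <= (s i).+1.
Proof.
move=> sI I0; apply/exists_inP; rewrite -[X in is_true X]negbK negb_exists_in.
apply/negP => /forall_inP H.
have {}H i : i \in I -> s i < #|I|.-1.
  by move=> /H; rewrite -ltnNge; move: I0; rewrite -card_gt0; lia.
have : #|I| <= #|I|.-1.
  rewrite -[X in _ <= X](size_iota 0) [X in X <= _]cardE -(size_map s).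
  apply: uniq_leq_size => [|w /mapP[i]].
    by rewrite map_inj_in_uniq ?enum_uniq // => i j; rewrite !mem_enum; apply: sI.
  by rewrite mem_enum => /H iI ->; rewrite mem_iota.
by move: I0; rewrite -card_gt0; lia.
Qed.

(** On [P], [s] occupies at most [#|P|] of the numbers below [#|S|], so enough stay free for
    [S :\: P]. The bound [#|S|] later keeps new values inside long lines. *)
Lemma extend_injection (T : finType) (S P : {set T}) (s : T -> nat) :
  P \subset S -> {in P &, injective s} ->
  exists s' : T -> nat,
    [/\ {in S &, injective s'}, {in P, s' =1 s}
      & {in S :\: P, forall i, s' i < #|S|}].
Proof.
move=> PS sI; have [S0 | S0] := posnP #|S|.
  exists s; move/eqP: S0; rewrite cards_eq0 => /eqP ->.
  by split=> // i; rewrite !inE ?andbF.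
pose B := [set v : 'I_#|S| | val v \notin [seq s j | j in P]].
have cB : #|S| - #|P| <= #|B|.
  have := leq_card_preim_image s P (@val_inj _ _ 'I_#|S|).
  have := cardsC B; rewrite card_ord.
  have -> : ~: B = [set v | val v \in [seq s j | j in P]].
    by apply/setP => v; rewrite !inE negbK.
  by move=> cB le_P; rewrite leq_subLR -[X in X <= _]cB addnC leq_add2r.
have [I sI' I0|f [fI fB]] := @greedy_sdr T _ (Ordinal S0) (fun=> B) (S :\: P).
  have /set0Pn[i iI] := I0; exists i => //; apply: leq_trans cB.
  by rewrite -(setIidPr PS) -cardsD subset_leq_card.
have out i j : i \in S :\: P -> j \in P -> val (f i) <> s j.
  move=> /fB; rewrite inE => fi jP e; case/negP: fi; rewrite e.
  by apply: image_f.
exists (fun i => if i \in P then s i else f i); split.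
- move=> i j iS jS; case: ifPn => iP; case: ifPn => jP e.
  + exact: sI.
  + by case: (@out j i) => //; rewrite inE jP.
  + by case: (@out i j) => //; rewrite inE iP.
  + by apply: fI; rewrite ?inE ?iP ?jP //; apply: val_inj.
- by move=> i ->.
- by move=> i; rewrite inE => /andP[/negPf-> _].
Qed.

(** * Distinct coordinates in Young diagrams *)

Section YoungDiagrams.

Variables (T : finType) (n : nat) (L : T -> nat -> nat -> bool).
Hypothesis Ldown : forall i s t s' t', s' <= s -> t' <= t -> L i s t -> L i s' t'.

Definition area (m : nat) (i : T) := \sum_(s < m) \sum_(t < m) L i s t.

(* inl t is the row [L i _ t], inr s the column [L i s _]; by monotonicity
   testing the k-th cell of a line tests whether it has at least k cells. *)
Definition long_lines (k : nat) (i : T) : {set 'I_n + 'I_n} :=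
  [set l : 'I_n + 'I_n | match l with inl t => L i k.-1 t | inr s => L i s k.-1 end].

Lemma card_long_lines k i :
  #|long_lines k i| = \sum_(t < n) L i k.-1 t + \sum_(s < n) L i s k.-1.
Proof.
rewrite -sum1_card big_mkcond big_sumType /=.
by congr (_ + _); apply: eq_bigr => v _; rewrite inE; case: (L _ _ _).
Qed.

(** By monotonicity a cell with [s >= k] lies in a long row, and one with [s < k <= t] in a long
    column; each long line is charged at most [n - k] cells. *)
Lemma area_le_long_lines k i : 0 < k -> k <= n ->
  area n i <= area k i + (n - k) * #|long_lines k i|.
Proof.
move=> k0 kn; have areaE m : area m i = \sum_(0 <= s < m) \sum_(0 <= t < m) L i s t.
  by rewrite big_mkord; apply: eq_bigr => s _; rewrite big_mkord.
rewrite card_long_lines !areaE (big_cat_nat _ kn) //= mulnDr addnCA addnC leq_add //.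
  rewrite -sum_nat_const_nat; rewrite big_nat_cond [X in _ <= X]big_nat_cond.
  apply: leq_sum => s /andP[/andP[ks _] _]; rewrite big_mkord.
  apply: leq_sum => t _; have := @Ldown i s t k.-1 t.
  by case: (L i s t) => // -> //; lia.
rewrite -(big_mkord xpredT (fun s => nat_of_bool (L i s k.-1))) big_distrr /=.
rewrite [X in _ <= _ + X](big_cat_nat _ kn) //= addnA.
apply: leq_trans (leq_addr _ _); rewrite -big_split /=.
apply: leq_sum => s _; rewrite (big_cat_nat _ kn) //= leq_add2l.
rewrite -sum_nat_const_nat big_nat_cond [X in _ <= X]big_nat_cond.
apply: leq_sum => t /andP[/andP[kt _] _]; have := @Ldown i s t s k.-1.
by case: (L i s t) => // -> //; lia.
Qed.

Lemma rainbow_by_averaging (S : {set T}) :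
  #|S| * (#|S| * (#|S| - 1)) < \sum_(i in S) area #|S| i ->
  exists s t : T -> nat,
    [/\ {in S &, injective s}, {in S &, injective t}
      & {in S, forall i, L i (s i) (t i)}].
Proof.
case Ek: #|S| => [|p].
  by rewrite big1 // => i _; rewrite /area big_ord0.
rewrite subn1 /= => Hsum.
pose r i : 'I_p.+1 := inord (index i (enum S)).
have rI : {in S &, injective r}.
  move=> i j iS jS /(congr1 val); rewrite /= !inordK -?Ek ?cardE ?index_mem ?mem_enum //.
  by move/(congr1 (nth i (enum S))); rewrite !nth_index ?mem_enum.
have shift i : area p.+1 i = \sum_(u < p.+1) \sum_(v < p.+1) L i (r i + u)%R (r i + v)%R.
  rewrite /area (reindex_inj (GRing.addrI (r i))); apply: eq_bigr => u _.
  by rewrite (reindex_inj (GRing.addrI (r i))).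
(* Averaging over the [p.+1 ^ 2] shifts; more than [p] hits among [p.+1] indices means that every
   index is hit. *)
have [u /existsP[v Huv]] : exists u : 'I_p.+1, [exists v : 'I_p.+1,
    p < \sum_(i in S) L i (r i + u)%R (r i + v)%R].
  apply/existsP; apply: contraLR Hsum; rewrite negb_exists => /forallP Hu.
  rewrite -leqNgt (eq_bigr _ (fun i _ => shift i)) exchange_big /=.
  rewrite -[X in X * _]card_ord -sum_nat_const; apply: leq_sum => u _.
  rewrite exchange_big /= -[X in X * _]card_ord -sum_nat_const.
  apply: leq_sum => v _; move: (Hu u); rewrite negb_exists => /forallP/(_ v).
  by rewrite -leqNgt.
exists (fun i => (r i + u)%R : 'I_p.+1), (fun i => (r i + v)%R : 'I_p.+1).
split=> [i j iS jS /val_inj/GRing.addIr | i j iS jS /val_inj/GRing.addIr | i iS].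
- exact: rI.
- exact: rI.
apply: contraLR Huv => /negPf Li; rewrite -leqNgt (big_setD1 i) //= Li add0n.
have Ep : #|S :\ i| = p by move: Ek; rewrite (cardsD1 i) iS => -[].
by rewrite -[X in _ <= X]Ep -sum1_card; apply: leq_sum => j _; case: (L _ _ _).
Qed.

Lemma rainbow_of_long_lines (S J : {set T}) (s t : T -> nat) : 0 < n ->
  J \subset S -> {in J &, injective s} -> {in J &, injective t} ->
  {in J, forall i, L i (s i) (t i)} ->
  (forall I : {set T}, I \subset S :\: J -> I != set0 ->
     #|I| * (#|I| - 1) + 2 * #|J| * #|I| < \sum_(i in I) #|long_lines #|S| i|) ->
  exists s' t' : T -> nat,
    [/\ {in S &, injective s'}, {in S &, injective t'}
      & {in S, forall i, L i (s' i) (t' i)}].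
Proof.
move=> n0 JS sI tI st HI.
pose g (l : 'I_n + 'I_n) : nat + nat :=
  match l with inl v => inl (val v) | inr v => inr (val v) end.
have gI : injective g by move=> [u|u] [v|v] //= [] /val_inj ->.
(* [f] lists the row ([true]) and the column ([false]) of each cell placed by [J]; [U] is the set of
   these forbidden lines. *)
pose f (x : T * bool) : nat + nat := if x.2 then inl (t x.1) else inr (s x.1).
pose U := [set l | g l \in [seq f x | x in setX J [set: bool]]].
have cU : #|U| <= #|J| * 2.
  have := leq_card_preim_image f (setX J [set: bool]) gI.
  by rewrite cardsX cardsT card_bool.
have [I IS I0|l [lI lB]] := @greedy_sdr _ _ (inl (Ordinal n0))
    (fun i => long_lines #|S| i :\: U) (S :\: J).
  apply/exists_inP; apply: contraLR (HI I IS I0).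
  rewrite negb_exists_in => /forall_inP small; rewrite -leqNgt.
  have -> : #|I| * (#|I| - 1) + 2 * #|J| * #|I| = #|I| * (#|I| - 1 + 2 * #|J|) by nia.
  rewrite -sum_nat_const; apply: leq_sum => i /small; rewrite -ltnNge cardsD.
  have := leq_trans (subset_leq_card (subsetIr (long_lines #|S| i) U)) cU.
  set x := #|_ :&: _|; set y := #|long_lines _ _|; lia.
(* [c] reads off the coordinate that a line fixes, if any; the other indices receive free values
   below [#|S|]. It is applied once per coordinate. *)
have extend (c : 'I_n + 'I_n -> option 'I_n) (s0 : T -> nat) :
    {in J &, injective s0} ->
    (forall l1 l2 v, c l1 = Some v -> c l2 = Some v -> l1 = l2) ->
    (forall i j v, i \in S :\: J -> j \in J -> c (l i) = Some v -> val v <> s0 j) ->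
    exists s' : T -> nat, [/\ {in S &, injective s'}, {in J, s' =1 s0}
      & {in S :\: J, forall i, if c (l i) is Some v then s' i = v else s' i < #|S|}].
  move=> s0I cI cJ.
  pose P := J :|: [set i in S :\: J | c (l i) != None].
  pose s1 i := if i \in J then s0 i else if c (l i) is Some v then val v else 0.
  have PS : P \subset S.
    rewrite subUset JS; apply/subsetP => i; rewrite inE => /andP[].
    by rewrite inE => /andP[].
  have [|s' [s'I s'P s'out]] := @extend_injection T S P s1 PS.
    move=> i j; rewrite /s1 !inE.
    case: (boolP (i \in J)) => iJ; case: (boolP (j \in J)) => jJ //=.
    - by move=> _ _; apply: s0I.
    - case E: (c (l j)) => [v|]; rewrite ?andbF // andbT => _ jS /esym.
      by move/(cJ j i v); rewrite inE jJ; case.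
    - case E: (c (l i)) => [v|]; rewrite ?andbF // andbT => iS _.
      by move/(cJ i j v); rewrite inE iJ; case.
    case E: (c (l i)) => [v|]; rewrite ?andbF // andbT => iS.
    case E': (c (l j)) => [w|]; rewrite ?andbF // andbT => jS /val_inj vw.
    apply: lI; rewrite ?inE ?iJ ?jJ //; apply: cI E _; by rewrite vw.
  exists s'; split=> // [i iJ | i iSJ].
    by rewrite s'P ?inE ?iJ // /s1 iJ.
  have iJ : (i \in J) = false by move: iSJ; rewrite inE => /andP[/negPf].
  have iS : i \in S by move: iSJ; rewrite inE => /andP[].
  case E: (c (l i)) => [v|].
    by rewrite s'P ?inE ?iS ?E ?iJ // /s1 iJ E.
  by apply: s'out; rewrite !inE iS iJ E.
have lU i x : i \in S :\: J -> x \in setX J [set: bool] -> g (l i) <> f x.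
  move=> /lB; rewrite inE => /andP[+ _] xJ e; rewrite inE e => /negP; apply.
  exact: image_f.
have [||s' [s'I s'J s'l]] := extend (fun l => if l is inr v then Some v else None) s sI.
- by move=> [l1|l1] [l2|l2] v //= [->] [->].
- move=> i j v iS jJ; case E: (l i) => [w|w] // [<-] e.
  by apply: (lU i (j, false) iS); rewrite ?inE ?jJ // E /= e.
have [||t' [t'I t'J t'l]] := extend (fun l => if l is inl v then Some v else None) t tI.
- by move=> [l1|l1] [l2|l2] v //= [->] [->].
- move=> i j v iS jJ; case E: (l i) => [w|w] // [<-] e.
  by apply: (lU i (j, true) iS); rewrite ?inE ?jJ // E /= e.
exists s', t'; split=> // i iS; have [iJ | iJ] := boolP (i \in J).
  by rewrite s'J // t'J //; apply: st.
have iSJ : i \in S :\: J by rewrite inE iJ.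
(* One coordinate is that of the long line, the other at most [#|S| - 1], so the cell is in the
   diagram. *)
have := lB i iSJ; rewrite inE => /andP[_].
have := s'l i iSJ; have := t'l i iSJ.
rewrite inE; case: (l i) => v; first by move=> -> lt; apply: Ldown => //; lia.
by move=> lt ->; apply: Ldown => //; lia.
Qed.

Lemma rainbow_young (S : {set T}) : 0 < n ->
  (forall I : {set T}, I \subset S -> I != set0 ->
     n * #|I| * (#|I| - 1) < \sum_(i in I) area n i) ->
  exists s t : T -> nat,
    [/\ {in S &, injective s}, {in S &, injective t}
      & {in S, forall i, L i (s i) (t i)}].
Proof.
move=> n0; have [m] := ubnP #|S|; elim: m S => // m IHm S ltSm HS.
have [-> | S0] := eqVneq S set0.
  by exists (fun=> 0), (fun=> 0); split=> i; rewrite inE.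
have k0 : 0 < #|S| by rewrite card_gt0.
pose few (J : {set T}) :=
  (J \subset S) && (\sum_(i in J) #|long_lines #|S| i| <= #|J| * (#|J| - 1)).
have [fewS | manyS] := boolP (few S).
  case/andP: fewS => _ fewS; apply: rainbow_by_averaging.
  have areaS := HS S (subxx S) S0.
  (* Each area is at most [n * n], which forces [#|S| - 1 < n]. *)
  have kn : #|S| <= n.
    have : \sum_(i in S) area n i <= #|S| * (n * n).
      rewrite -sum_nat_const; apply: leq_sum => i _.
      rewrite -[n in n * _]card_ord -sum_nat_const; apply: leq_sum => s _.
      rewrite -[X in _ <= X]muln1 -[X in X * _]card_ord -sum_nat_const.
      by apply: leq_sum => t _; case: (L _ _ _).
    move: areaS; nia.
  have : \sum_(i in S) area n i <= \sum_(i in S) area #|S| i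
           + (n - #|S|) * \sum_(i in S) #|long_lines #|S| i|.
    rewrite big_distrr -big_split /=; apply: leq_sum => i _.
    exact: area_le_long_lines.
  (* From [n * k * (k - 1) < A], [A <= B + (n - k) * C] and [C <= k * (k - 1)] follows
     [k * (k * (k - 1)) < B]. *)
  move: areaS fewS; set A := \sum_(i in S) _; set B := \sum_(i in S) _.
  set C := \sum_(i in S) _; set k := #|S| in kn *; move: kn => /subnKC <-.
  rewrite addKn; nia.
have few0 : few set0 by rewrite /few sub0set big_set0.
case: (arg_maxnP (fun J : {set T} => #|J|) few0) => J /andP[JS Jfew] Jmax.
have ltJS : #|J| < #|S|.
  rewrite ltnNge; apply: contra manyS => leSJ.
  by have /eqP <- : J == S; [rewrite eqEcard JS | rewrite /few JS].
have [||s [t [sI tI st]]] := IHm J.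
- exact: leq_trans ltJS _.
- by move=> I IJ; apply: HS; apply: subset_trans JS.
apply: (rainbow_of_long_lines n0 JS sI tI st) => I IS I0.
have dIJ : [disjoint J & I].
  rewrite disjoint_sym; apply/pred0P => i /=; apply/negP => /andP[/(subsetP IS)].
  by rewrite inE => /andP[/negP].
have cU : #|J :|: I| = #|J| + #|I| by rewrite cardsU disjoint_setI0 // cards0 subn0.
have : ~~ few (J :|: I).
  apply/negP => /Jmax; rewrite cU; move: I0; rewrite -card_gt0; lia.
rewrite /few subUset JS (subset_trans IS) ?subsetDl //= -ltnNge cU.
rewrite (eq_bigl [predU J & I]) => [|i]; last by rewrite !inE.
rewrite bigU //= => many.
(* The cross term [2 * a * b] pays for the lines blocked by [J]. *)
have sqE a b : (a + b) * (a + b - 1) = a * (a - 1) + (b * (b - 1) + 2 * a * b).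
  case: a b => [|a] [|b]; try lia.
  by rewrite addSn addnS (subn1 a.+1) (subn1 b.+1) (subn1 _.+2) -!pred_Sn; lia.
rewrite sqE in many; rewrite -(ltn_add2l (#|J| * (#|J| - 1))).
by apply: leq_trans many _; rewrite leq_add2r.
Qed.

End YoungDiagrams.

(** * From diagrams back to bipartite graphs *)

Theorem theorem4p1 (n k : nat) (F : 'I_k -> {set edge n}) :
  1 <= n -> 1 <= k ->
  (forall I : {set 'I_k}, I != set0 ->
     \sum_(i in I) #|F i| > n * #|I| * (#|I| - 1)) ->
  rainbow_matching F.
Proof.
move=> n0 _ HF.
pose N i (x : 'I_n) : {set 'I_n} := [set y | (x, y) \in F i].
pose A i t : {set 'I_n} := [set x | t < #|N i x|].
pose L i s t := s < #|A i t|.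
(* Double counting: both sides equal the sum of the left degrees. *)
have areaL i : area L n i = #|F i|.
  rewrite /area exchange_big /=.
  have count_lt m : m <= n -> \sum_(v < n) (v < m) = m.
    move=> mn; rewrite -[RHS]card_ord -sum1_card (big_ord_widen _ (fun=> 1) mn).
    by rewrite [RHS]big_mkcond; apply: eq_bigr => v _; case: (_ < _).
  have le_n (X : {set 'I_n}) : #|X| <= n by rewrite -[n in _ <= n]card_ord max_card.
  under eq_bigr => t _ do rewrite (count_lt _ (le_n _)) -sum1_card big_mkcond.
  have -> : #|F i| = \sum_(x < n) \sum_(y < n) ((x, y) \in F i).
    rewrite pair_bigA -sum1_card big_mkcond /=.
    by apply: eq_bigr => -[x y] _ /=; case: ifP.
  rewrite exchange_big /=.
  apply: eq_bigr => x _; rewrite -[RHS](_ : #|N i x| = _).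
    rewrite -[RHS](count_lt _ (le_n _)); apply: eq_bigr => t _.
    by rewrite inE; case: (_ < _).
  by rewrite -sum1_card big_mkcond; apply: eq_bigr => y _; rewrite inE; case: (_ \in _).
have [||s [t [sI tI st]]] := @rainbow_young _ n L _ setT n0.
- move=> i s t s' t' ss tt; rewrite /L => /(leq_ltn_trans ss) /leq_trans; apply.
  apply: subset_leq_card; apply/subsetP => x; rewrite !inE.
  exact: leq_ltn_trans.
- by move=> I _ I0; under eq_bigr do rewrite areaL; apply: HF.
(* In any [I], the index with the largest [s i] has at least [#|I|] candidates, since
   [s i < #|A i (t i)|]. Then [t i < #|N i (x i)|] does the same for the right ends. *)
have [I _ I0|x [xI xA]] :=
    @greedy_sdr _ _ (Ordinal n0) (fun i => A i (t i)) [set: 'I_k].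
  have [|i iI le_I] := @exists_geq_card_of_inj _ s I _ I0.
    by move=> i j _ _; apply: sI.
  by exists i => //; apply: leq_trans le_I (st i _).
have [I _ I0|y [yI yN]] :=
    @greedy_sdr _ _ (Ordinal n0) (fun i => N i (x i)) [set: 'I_k].
  have [|i iI le_I] := @exists_geq_card_of_inj _ t I _ I0.
    by move=> i j _ _; apply: tI.
  by exists i => //; apply: leq_trans le_I _; have := xA i (in_setT i); rewrite inE.
exists (fun i => (x i, y i)); split=> [i | i j ij].
  by have := yN i (in_setT i); rewrite inE.
by apply/andP; split; apply: contraNneq ij => e; apply/eqP;
  [apply: xI | apply: yI].
Qed.
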